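(* For the homogeneous multi-agent ski-rental problem, the optimal randomized policy (minimizing the competitive ratio over all randomized policies, symmetric or not) is to randomly pick a common threshold day $T$ and to buy a group pass if the group reaches day $T$ (all agents renting before day $T$), where $T$ is drawn from the distribution on $\{1,2,\dots,\lceil G/M\rceil\}$ whose probabilities are proportional to $$r_t=\frac{M}{G}\left(1-\frac{M}{G}\right)^{\frac{G}{M}-t},\qquad t\in\left\{1,2,\dots,\left\lceil\frac{G}{M}\right\rceil\right\}.$$ This policy has competitive ratio $$\mathrm{CR}=\frac{1}{1-\left(1-\frac{M}{G}\right)^{\frac{G}{M}}}.$$
   Context: Homogeneous multi-agent ski-rental problem: $M,B,G$ are known positive integers with $B<G<MB$. There are $M$ agents, all with the same number $N\in\mathbb N^+$ of active days, unknown in advance to an online policy. On each day $t\le N$, each agent that has not yet bought a pass takes one of the actions: Rent (cost $1$), Ind (buy an individual pass, cost $B$, covering all its remaining active days), or Group (join the purchase of a group pass, cost $G/k$, where $k$ is the number of agents taking the action Group on that day, covering all its remaining active days). An agent that has already bought pays $0$ afterwards. A deterministic policy $\pi$ maps the history to one action for each agent; $\mathrm{Cost}(\pi,N)$ is the sum of all agents' costs over days $1,\dots,N$. A randomized policy $f$ is a probability distribution over deterministic policies, with cost $\mathrm{Cost}(f,N)=\mathbb E_{\pi\sim f}[\mathrm{Cost}(\pi,N)]$. The offline optimum is $\mathrm{OPT}(N)=\min\{G,M\min\{B,N\}\}$, and the competitive ratio is $\mathrm{CR}(f)=\max_{N\in\mathbb N^+}\mathrm{Cost}(f,N)/\mathr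m{OPT}(N)$.
   Formalization: Proved under the added assumption that M divides G; otherwise the claim fails: for M=2, B=2, G=3 the stated policy has ratio at least 3/2, not 1/(1-(1/3)^{3/2})≈1.238, and the mixture P(T=1)=4/7, P(T=2)=3/7 attains 9/7. *)

(* Defs.v *)
From HB Require Import structures.
From mathcomp Require Import all_boot all_order all_algebra.
From mathcomp Require Import all_classical all_reals all_analysis.
Set Implicit Arguments.
Unset Strict Implicit.
Unset Printing Implicit Defensive.
Import Order.TTheory GRing.Theory Num.Theory.
Local Open Scope classical_set_scope.
Local Open Scope ring_scope.

Inductive action := Rent | Ind | Group.

Definition nat_of_action (a : action) : nat :=
  match a with Rent => 0 | Ind => 1 | Group => 2 end.

Definition action_of_nat (n : nat) : option action :=
  match n with
  | 0 => Some Rent | 1 => Some Ind | 2 => Some Group | _ => None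
  end%N.

Lemma nat_of_actionK : pcancel nat_of_action action_of_nat.
Proof. by case. Qed.

HB.instance Definition _ := Countable.copy action (pcan_type nat_of_actionK).

Lemma action_enumP : Finite.axiom [:: Rent; Ind; Group].
Proof. by case. Qed.

HB.instance Definition _ := fintype.isFinite.Build action action_enumP.

Definition joint_action (M : nat) := {ffun 'I_M -> action}.

(* The joint actions of the past days, oldest first: [h] is what is known at
   the beginning of day [(size h).+1]. *)
Definition history (M : nat) := seq (joint_action M).

(* The entry of the joint action at an agent who already holds a pass has no
   effect: see [holds_pass] and [day_cost]. *)
Definition policy (M : nat) := history M -> joint_action M.

HB.instance Definition _ M := gen_eqMixin (policy M).
HB.instance Definition _ M := gen_choiceMixin (policy M).
HB.instance Definition _ M :=
  isPointed.Build (policy M) (fun=> [ffun=> Rent]).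

Section model.
Context {R : realType} {M : nat}.

Definition holds_pass (h : history M) (i : 'I_M) : bool :=
  has (fun a : joint_action M => a i != Rent) h.

Definition group_size (h : history M) (a : joint_action M) : nat :=
  #|[set i : 'I_M | ~~ holds_pass h i & a i == Group]|.

Definition day_cost (B G : nat) (h : history M) (a : joint_action M) : R :=
  \sum_(i < M | ~~ holds_pass h i)
    match a i with
    | Rent => 1
    | Ind => B%:R
    | Group => G%:R / (group_size h a)%:R
    end.

Definition play (pi : policy M) (t : nat) : history M :=
  iter t (fun h => rcons h (pi h)) [::].

Definition cost (B G : nat) (pi : policy M) (N : nat) : R :=
  \sum_(t < N) day_cost B G (play pi t) (pi (play pi t)).

End model.

(* Policies carry the product sigma-algebra, generated by the evaluations. *)
Definition cylinders (M : nat) : set (set (policy M)) :=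
  [set [set pi | pi h = a] | h in [set: history M] & a in [set: joint_action M]].
Arguments cylinders : clear implicits.

Notation policy_space M := (g_sigma_algebraType (cylinders M)).

Notation randomized_policy M R := (probability (policy_space M) R).

Definition OPT (M B G N : nat) : nat := minn G (M * minn B N).

Definition expected_cost {R : realType} {M : nat} (B G : nat)
    (f : randomized_policy M R) (N : nat) : \bar R :=
  'E_f[fun pi => cost B G pi N].

Definition competitive_ratio {R : realType} {M : nat} (B G : nat)
    (f : randomized_policy M R) : \bar R :=
  ereal_sup [set (expected_cost B G f N / ((OPT M B G N)%:R)%:E)%E
            | N in [set N : nat | (0 < N)%N]].

(* Day [T] is reached with a history of size [T.-1]. *)
Definition threshold_policy (M T : nat) : policy_space M :=
  fun h => [ffun=> if (size h).+1 == T then Group else Rent].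
Arguments threshold_policy : clear implicits.

Lemma measurable_threshold_policy M :
  measurable_fun [set: nat] (threshold_policy M).
Proof. by []. Qed.

HB.instance Definition _ M :=
  isMeasurableFun.Build _ _ nat (policy_space M)
    (threshold_policy M) (@measurable_threshold_policy M).

Section optimal_policy.
Variables (R : realType) (M G : nat).

Definition threshold_weight (t : nat) : R :=
  M%:R / G%:R * (1 - M%:R / G%:R) `^ (G%:R / M%:R - t%:R).

Lemma threshold_weight_ge0 t : 0 <= threshold_weight t.
Proof. by rewrite mulr_ge0 ?powR_ge0// divr_ge0. Qed.

Definition max_threshold : nat := `|Num.ceil (G%:R / M%:R : R)|%N.

(* The second argument of [mnormalize] is only used when the total weight
   vanishes. *)
Definition threshold_law : probability nat R :=
  mnormalize
    (msum (fun k => mscale (NngNum (threshold_weight_ge0 k.+1)) \d_k.+1)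
          max_threshold)
    \d_1%N.

Definition random_threshold_policy : randomized_policy M R :=
  distribution threshold_law (threshold_policy M).

End optimal_policy.

(* Main.v *)
Require Import Defs.
From HB Require Import structures.
From mathcomp Require Import all_boot all_order all_algebra.
From mathcomp Require Import all_classical all_reals all_analysis.
From mathcomp Require Import measurable_realfun ring lra.
Import Order.TTheory GRing.Theory Num.Theory.
Local Open Scope ring_scope.

(* Write G = K M, so that K < B, and a = 1 - 1/K.  A purchase of either kind
   costs at least K per agent, hence each agent faces a ski-rental problem with
   buying price at least K.  Drawing the threshold with weights a ^ (K - t) / K
   makes the expected cost equal to OPT(N) / (1 - a ^ K) for every horizon N, so
   the competitive ratio is 1 / (1 - a ^ K).  For optimality, a random horizon
   with geometric tails a ^ (t - 1) up to day K makes every deterministic policy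
   pay at least G on average while the average optimum is G (1 - a ^ K). *)

(** * Geometric sums over thresholds and horizons *)

Section geometric_sums.
Variables (R : comPzRingType) (q a : R).
(** This is a = 1 - 1/q without division; q is K in the application. *)
Hypothesis qa : q * a = q - 1.

Lemma geometric_sum m : \sum_(j < m) a ^+ (m - j.+1) = q * (1 - a ^+ m).
Proof.
elim: m => [|m IH]; first by rewrite big_ord0 expr0 subrr mulr0.
rewrite big_ord_recr /= subnn expr0.
under eq_bigr => j _ do rewrite subSS -(subnSK (ltn_ord j)) exprS.
by rewrite -mulr_sumr IH exprS; ring: qa.
Qed.

(** The summand is the cost of renting j days and then buying at price q. From n to n + 1 the
    earlier terms are multiplied by a, and a q n + n + q = q (n + 1) because q a = q - 1. *)
Lemma arithmetic_geometric_sum n :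
  \sum_(j < n) a ^+ (n - j.+1) * (j%:R + q) = q * n%:R.
Proof.
elim: n => [|n IH]; first by rewrite big_ord0 mulr0.
rewrite big_ord_recr /= subnn expr0 mul1r.
under eq_bigr => j _ do rewrite subSS -(subnSK (ltn_ord j)) exprS -mulrA.
by rewrite -mulr_sumr IH -natr1; ring: qa.
Qed.

(** With a horizon of n days, the first n thresholds lead to a purchase and contribute a^m q n; the
    last m lead to n days of rent and contribute q (1 - a^m) n. *)
Lemma truncated_geometric_sum n m :
  \sum_(j < n + m) a ^+ (n + m - j.+1) *
    ((minn j n)%:R + (if (j < n)%N then q else 0)) = q * n%:R.
Proof.
rewrite big_split_ord /=.
under eq_bigr => j _.
  rewrite ltn_ord (minn_idPl (ltnW (ltn_ord j))) addnC -addnBA//.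
  rewrite exprD -mulrA; over.
rewrite -mulr_sumr arithmetic_geometric_sum.
under eq_bigr => j _.
  rewrite ltnNge leq_addr /= addr0 (minn_idPr (leq_addr _ _)) -addnS subnDl.
  over.
by rewrite -mulr_suml geometric_sum; ring.
Qed.

(** Mean of a horizon with tails a^t truncated at n + 1, hence the sum of the tails a^0 + ... +
    a^n. *)
Lemma tail_weighted_sum (n : nat) :
  \sum_(j < n) (a ^+ j - a ^+ j.+1) * j.+1%:R + a ^+ n * n.+1%:R =
  q * (1 - a ^+ n.+1).
Proof.
elim: n => [|n IH]; first by rewrite big_ord0 expr0 expr1; ring: qa.
move: IH; rewrite big_ord_recr /= -[n.+2%:R]natr1 => /(canRL (addrK _)) ->.
by rewrite !exprS; ring: qa.
Qed.

End geometric_sums.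

(** * Active agents and the cost of a deterministic policy *)

Section dynamics.
Context {R : realType} {M : nat}.
Implicit Types (h : history M) (a : joint_action M) (pi : policy M).

Definition num_active h : nat := #|[set i | ~~ holds_pass h i]|.

Lemma holds_pass_rcons h a i :
  holds_pass (rcons h a) i = holds_pass h i || (a i != Rent).
Proof. by rewrite /holds_pass has_rcons orbC. Qed.

Lemma num_active_rcons_le h a : (num_active (rcons h a) <= num_active h)%N.
Proof.
apply/subset_leq_card/fintype.subsetP => i; rewrite !inE holds_pass_rcons.
by rewrite negb_or => /andP[].
Qed.

Lemma num_activeE h :
  (num_active h)%:R = \sum_(i < M | ~~ holds_pass h i) 1 :> R.
Proof. by rewrite sumr_const /num_active cardsE. Qed.

Lemma num_active_rconsE h a :
  (num_active (rcons h a))%:R =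
  \sum_(i < M | ~~ holds_pass h i) (a i == Rent)%:R :> R.
Proof.
rewrite num_activeE [RHS](bigID (fun i => a i == Rent)) /=.
rewrite [X in _ + X]big1 ?addr0; last by move=> i /andP[_ /negbTE ->].
apply: eq_big => [i|i]; first by rewrite holds_pass_rcons negb_or negbK.
by rewrite holds_pass_rcons negb_or negbK => /andP[_ ->].
Qed.

Lemma day_cost_ge0 B G h a : 0 <= day_cost B G h a :> R.
Proof. by apply: sumr_ge0 => i _; case: (a i). Qed.

Lemma cost_ge0 B G pi N : 0 <= cost B G pi N :> R.
Proof. by apply: sumr_ge0 => t _; exact: day_cost_ge0. Qed.

(* A group pass costs each participant at least [K], because at most [M] agents
   share it. *)
Lemma day_cost_ge B K h a : (K <= B)%N ->
  (num_active (rcons h a))%:R +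
    K%:R * ((num_active h)%:R - (num_active (rcons h a))%:R)
  <= day_cost B (K * M) h a :> R.
Proof.
move=> KB; rewrite num_active_rconsE num_activeE -sumrB mulr_sumr -big_split /=.
apply: ler_sum => i hi; case: eqP => [->|]; first by rewrite subrr mulr0 addr0.
case ai: (a i) => // _; rewrite add0r subr0 mulr1 ?ler_nat//.
have s_gt0 : (0 < group_size h a)%N.
  by apply/card_gt0P; exists i; rewrite inE hi ai eqxx.
rewrite ler_pdivlMr ?ltr0n// -natrM ler_nat leq_mul2l.
by rewrite -[X in (_ <= X)%N](card_ord M) max_card orbT.
Qed.

Lemma costS B G pi N :
  cost B G pi N.+1 =
  cost B G pi N + day_cost B G (play pi N) (pi (play pi N)) :> R.
Proof. exact: big_ord_recr. Qed.

Section lower_bound.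
Variables (B K : nat) (pi : policy M).
Hypotheses (K_gt0 : (0 < K)%N) (KB : (K <= B)%N).
Let n t : R := (num_active (play pi t))%:R.
Let C t : R := cost B (K * M) pi t.
Let a : R := 1 - K%:R^-1.

Let num_active_step t : n t.+1 <= n t.
Proof. by rewrite ler_nat num_active_rcons_le. Qed.

Let cost_step t : C t + n t.+1 + K%:R * (n t - n t.+1) <= C t.+1.
Proof. by rewrite /C costS -addrA lerD2l day_cost_ge. Qed.

Let Ka : K%:R * a = K%:R - 1.
Proof. by rewrite /a mulrBr mulr1 mulfV// pnatr_eq0 -lt0n. Qed.

Let a_ge0 : 0 <= a.
Proof. by rewrite subr_ge0 invf_le1 ?ltr0n// ler1n. Qed.

(** Each agent who buys during these j days pays at least K, and each one still active has paid j
    days of rent. *)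
Let cost_tail m j :
  C m + K%:R * (n m - n (m + j)) + j%:R * n (m + j) <= C (m + j).
Proof.
elim: j => [|j IH]; first by rewrite addn0 subrr mulr0 mul0r !addr0.
rewrite addnS -natr1; have := num_active_step (m + j).
have := cost_step (m + j).
have j0 : 0 <= j%:R :> R by [].
by move=> cs ns; have := ler_wpM2l j0 ns; lra.
Qed.

(** [C m + K * n m] is a potential: the past cost plus a price K for every active agent. Since K a =
    K - 1, the right-hand side grows from m to m + 1 by exactly a^m times the slack of
    [cost_step]. *)
Let tail_weighted_cost_prefix m :
  K%:R * n 0 <= \sum_(N < m) (a ^+ N - a ^+ N.+1) * C N.+1
                + a ^+ m * (C m + K%:R * n m).
Proof.
elim: m => [|m IH].
  by rewrite big_ord0 expr0 mul1r add0r /C /cost big_ord0 add0r.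
apply: le_trans IH _; rewrite big_ord_recr /= -addrA lerD2l exprS.
have := ler_wpM2l (exprn_ge0 m a_ge0) (cost_step m).
rewrite -subr_ge0 => le0; rewrite -subr_ge0; apply: le_trans le0 _.
rewrite le_eqVlt; apply/orP; left; apply/eqP; ring: Ka.
Qed.

(* The adversary stops on day [N.+1 < K] with probability [a ^+ N - a ^+ N.+1]
   and on day [2 * K - 1] otherwise, so that it still plays on day [t.+1] with
   probability [a ^+ t] for [t < K]; the [K] days of play from day [K] on make
   renting on all of them as expensive as buying on day [K]. *)
Lemma tail_weighted_cost_ge :
  (K * M)%:R <= \sum_(N < K.-1) (a ^+ N - a ^+ N.+1) * cost B (K * M) pi N.+1
                + a ^+ K.-1 * cost B (K * M) pi (K.-1 + K) :> R.
Proof.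
have -> : (K * M)%:R = K%:R * n 0.
  rewrite natrM /n num_activeE /= -[in LHS](card_ord M) -sum1_card natr_sum.
  by congr (_ * _).
apply: le_trans (tail_weighted_cost_prefix K.-1) _; rewrite lerD2l.
apply: ler_wpM2l; first exact: exprn_ge0.
by have := cost_tail K.-1 K; rewrite -/(C _); lra.
Qed.

End lower_bound.
End dynamics.

(** * Measurability of the cost *)

Section measurability.
Context {M : nat}.

Lemma measurable_action h a :
  measurable [set pi : policy_space M | (pi : policy M) h = a].
Proof. by apply: sub_sigma_algebra; exists h => //; exists a. Qed.

(** Histories and joint actions are countably many, so the event is a countable union of pieces that
    fix the play of t days and, by a cylinder, the next joint action. *)
Lemma measurable_play_action t (A : history M -> joint_action M -> Prop) :
  measurable [set pi : policy_space M | A (play pi t) (pi (play pi t))].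
Proof.
have measurable_next t' A' :
    (forall h, measurable [set pi : policy_space M | play pi t' = h]) ->
    measurable [set pi : policy_space M | A' (play pi t') (pi (play pi t'))].
  move=> mplay.
  rewrite [X in measurable X](_ : _ = (\bigcup_(ha : history M * joint_action M)
    ([set pi : policy_space M | play pi t' = ha.1] `&`
     [set pi : policy_space M |
       (pi : policy M) ha.1 = ha.2 /\ A' ha.1 ha.2]))%classic).
    apply: countable_bigcupT_measurable => [|[h a] /=]; first exact: countableP.
    apply: measurableI; first exact: mplay.
    have [Aha|nAha] := pselect (A' h a).
      rewrite [X in measurable X](_ : _ =
        [set pi | (pi : policy M) h = a]%classic).
        exact: measurable_action.
      by apply/seteqP; split=> [pi []|pi].
    rewrite [X in measurable X](_ : _ = set0)//.
    by apply/seteqP; split=> [pi []|pi].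
  apply/seteqP; split=> [pi Api|pi [[h a] _ /= [<- [<-]]]]//.
  by exists (play pi t', pi (play pi t')).
apply: (measurable_next t A); elim: t => [|t IH] h.
  have [<-|nh] := eqVneq [::] h.
    by rewrite [X in measurable X](_ : _ = setT)//; apply/seteqP; split.
  rewrite [X in measurable X](_ : _ = set0)//.
  by apply/seteqP; split=> [pi|pi]//= /eqP; rewrite (negbTE nh).
(* [play pi t.+1 = h] is itself a condition on the play of t days and the next joint action. *)
exact: (measurable_next t (fun h' a => rcons h' a = h)).
Qed.

Lemma measurable_cost (R : realType) B G N :
  measurable_fun setT (fun pi : policy_space M => cost B G pi N : R).
Proof.
apply: measurable_sum => t _ Y mY; rewrite setTI.
exact: (measurable_play_action t (fun h a => Y (day_cost B G h a))).
Qed.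

End measurability.

(** * From deterministic to randomized policies *)

Lemma OPT_gt0 M B G N : (0 < M)%N -> (0 < B)%N -> (0 < G)%N -> (0 < N)%N ->
  (0 < OPT M B G N)%N.
Proof.
by move=> M0 B0 G0 N0; rewrite /OPT leq_min G0 muln_gt0 M0 leq_min B0.
Qed.

Lemma OPT_mulE K M B N : (K < B)%N -> OPT M B (K * M) N = (minn K N * M)%N.
Proof.
move=> KB; rewrite /OPT [(K * M)%N]mulnC -minnMr mulnC minnA.
by rewrite (minn_idPl (ltnW KB)).
Qed.

(** Nonnegativity stands in for integrability: the pointwise bound is integrated in the extended
    reals. *)
Lemma le_sum_expectation d (T : measurableType d) (R : realType)
    (P : probability T R) (n : nat) (w : nat -> R) (X : nat -> T -> R) (v : R) :
  0 <= v -> (forall i, 0 <= w i) -> (forall i x, 0 <= X i x) ->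
  (forall i, measurable_fun setT (X i)) ->
  (forall x, v <= \sum_(i < n) w i * X i x) ->
  (v%:E <= \sum_(i < n) (w i)%:E * 'E_P[X i])%E.
Proof.
move=> v0 w0 X0 mX vle.
have mE i : measurable_fun setT (fun x => (X i x)%:E) by exact/measurable_EFinP.
have mwE i : measurable_fun setT (fun x => (w i)%:E * (X i x)%:E)%E.
  exact: measurable_funeM.
rewrite -(expectation_cst P v) unlock; apply: (@le_trans _ _
  (\int[P]_x (\sum_(i < n) (w i)%:E * (X i x)%:E))%E).
  apply: ge0_le_integral => //.
  - exact: (measurable_cst v%:E).
  - exact: emeasurable_sum.
  - by move=> x _; under eq_bigr do rewrite -EFinM; rewrite sumEFin lee_fin vle.
rewrite ge0_integral_sum//; last first.
  by move=> i x _; rewrite -EFinM lee_fin mulr_ge0.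
apply: lee_sum => i _; rewrite ge0_integralZl_EFin// => x _.
by rewrite lee_fin.
Qed.

Section yao.
Context {R : realType} {M : nat}.
Variables (B G : nat).
Hypotheses (M_gt0 : (0 < M)%N) (B_gt0 : (0 < B)%N) (G_gt0 : (0 < G)%N).

(* Yao's principle: the horizon is [d i] with weight [w i]. *)
Lemma competitive_ratio_ge (f : randomized_policy M R) (n : nat)
    (w : nat -> R) (d : nat -> nat) (v : R) : 0 <= v ->
  (forall i, 0 <= w i) -> (forall i, 0 < d i)%N ->
  0 < \sum_(i < n) w i * (OPT M B G (d i))%:R ->
  (forall pi : policy M, v <= \sum_(i < n) w i * cost B G pi (d i)) ->
  ((v / \sum_(i < n) w i * (OPT M B G (d i))%:R)%:E
    <= competitive_ratio B G f)%E.
Proof.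
move=> v0 w0 d0 s_gt0 vle.
have E_ge0 N : (0 <= expected_cost B G f N)%E.
  by apply: expectation_ge0 => pi; exact: cost_ge0.
have ratio_le N : (0 < N)%N ->
    (expected_cost B G f N / ((OPT M B G N)%:R)%:E
      <= competitive_ratio B G f)%E.
  by move=> N0; apply: ereal_sup_ubound; exists N.
have invE N : (0 < N)%N ->
    ((((OPT M B G N)%:R : R)%:E)^-1 = ((OPT M B G N)%:R^-1)%:E)%E.
  by move=> N0; rewrite inver pnatr_eq0 -[_ == 0%N]negbK -lt0n OPT_gt0.
(* Excludes the value -oo; the bound is trivial for +oo, which leaves a real ratio [r]. *)
have : (0 <= competitive_ratio B G f)%E.
  apply: le_trans (ratio_le 1%N isT); apply: mule_ge0 => //.
  by rewrite invE// lee_fin.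
move: ratio_le; case: (competitive_ratio B G f) => [r|_ _|//]; last first.
  by rewrite leey.
move=> ratio_le r_ge0; rewrite lee_fin ler_pdivrMr//.
have E_le N : (0 < N)%N ->
    (expected_cost B G f N <= (r * (OPT M B G N)%:R)%:E)%E.
  move=> N0; have := ratio_le N N0; rewrite invE// EFinM.
  by rewrite lee_pdivrMr ?ltr0n ?OPT_gt0.
rewrite -lee_fin mulr_sumr -sumEFin; apply: (@le_trans _ _
  (\sum_(i < n) (w i)%:E * expected_cost B G f (d i))%E).
  apply: (@le_sum_expectation _ (policy_space M) R f n w
    (fun i pi => cost B G pi (d i)) v) => //.
  - by move=> i pi; exact: cost_ge0.
  - by move=> i; exact: measurable_cost.
apply: lee_sum => i _.
by rewrite mulrCA EFinM; apply: lee_wpmul2l; rewrite ?lee_fin// E_le.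
Qed.

End yao.

(** * Cost of threshold policies and of their mixture *)

Lemma size_play M (pi : policy M) t : size (play pi t) = t.
Proof. by elim: t => //= t IH; rewrite size_rcons IH. Qed.

Lemma holds_pass_threshold M T t (i : 'I_M) : (0 < T)%N ->
  holds_pass (play (threshold_policy M T) t) i = (T <= t)%N.
Proof.
move=> T0; elim: t => [|t IH]; first by rewrite leqNgt T0.
rewrite [play _ _]/= -/(play _ _) holds_pass_rcons IH ffunE size_play.
by rewrite [RHS]leq_eqVlt ltnS orbC [T == _]eq_sym; case: (_ == T).
Qed.

Lemma day_cost_threshold (R : realType) M B G T t : (0 < M)%N -> (0 < T)%N ->
  let h := play (threshold_policy M T) t in
  day_cost B G h (threshold_policy M T h) =
  (if (t.+1 < T)%N then M%:R else if t.+1 == T then G%:R else 0) :> R.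
Proof.
move=> M0 T0 h; rewrite /day_cost.
have hE i : holds_pass h i = (T < t.+1)%N by rewrite holds_pass_threshold.
under eq_bigl => i do rewrite hE.
under eq_bigr => i do rewrite ffunE size_play.
case: (ltngtP t.+1 T) => [tT|tT|tT] /=.
- by rewrite sumr_const card_ord.
- by rewrite big_pred0.
(* Nobody has bought before day T, so all M agents join and the M shares G/M add up to G. *)
have -> : group_size h (threshold_policy M T h) = M.
  rewrite /group_size -[RHS](card_ord M) -cardsT; congr #|pred_of_set _|.
  by apply/setP => i; rewrite !inE hE ffunE size_play tT ltnn !eqxx.
by rewrite sumr_const card_ord -[LHS]mulr_natr mulfVK// pnatr_eq0 -lt0n.
Qed.

Lemma cost_threshold (R : realType) M B G j N : (0 < M)%N ->
  cost B G (threshold_policy M j.+1) N =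
  (minn j N * M)%:R + (if (j < N)%N then G%:R else 0) :> R.
Proof.
move=> M0; elim: N => [|N IH].
  by rewrite minn0 mul0n ltn0 addr0 /cost big_ord0.
rewrite costS IH day_cost_threshold// !ltnS eqSS.
case: ltngtP => [jN|Nj|->]; rewrite ?addr0.
- by rewrite (minn_idPl (leqW (ltnW jN))).
- by rewrite (minn_idPr Nj) mulSnr natrD.
- by rewrite (minn_idPl (leqnSn _)).
Qed.

(** A positive finite total mass W avoids the default value [P], so [mnormalize] is scaling by
    1/W. *)
Lemma ge0_integral_mnormalize d (T : measurableType d) (R : realType)
    (mu : {measure set T -> \bar R}) (P : probability T R) (W : R)
    (f : T -> \bar R) :
  0 < W -> mu setT = W%:E -> measurable_fun setT f -> (forall x, 0 <= f x)%E ->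
  (\int[mnormalize mu P]_x f x = (W^-1)%:E * \int[mu]_x f x)%E.
Proof.
move=> W0 muT mf f0; have W'0 : 0 <= W^-1 by rewrite invr_ge0 ltW.
rewrite [LHS](eq_measure_integral (mscale (NngNum W'0) mu)) => [|A mA _].
  by rewrite ge0_integral_mscale.
by rewrite /= /mnormalize muT eqe gt_eqF//= /mscale /= muleC.
Qed.

Lemma expected_cost_random_threshold (R : realType) M B G N :
  let W := \sum_(j < max_threshold R M G) threshold_weight R M G j.+1 in
  0 < W ->
  expected_cost B G (random_threshold_policy R M G) N =
  (W^-1 * \sum_(j < max_threshold R M G)
     threshold_weight R M G j.+1 * cost B G (threshold_policy M j.+1) N)%:E.
Proof.
move=> W W0; rewrite /expected_cost unlock.
have mC : measurable_fun [set: policy_space M]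
    (fun pi => (cost B G pi N : R)%:E).
  by apply/measurable_EFinP; exact: measurable_cost.
rewrite (@ge0_integral_distribution _ _ _ _ _ (threshold_law R M G)
  (threshold_policy M) (fun pi => (cost B G pi N)%:E))//; last first.
  by move=> pi; rewrite lee_fin cost_ge0.
rewrite (@ge0_integral_mnormalize _ _ _ _ _ W)//; last 2 first.
- rewrite /= /msum /W -sumEFin; apply: eq_bigr => j _.
  by rewrite /= /mscale /= diracT mule1.
- by move=> T; rewrite lee_fin cost_ge0.
rewrite ge0_integral_measure_sum//; last first.
  by move=> T _; rewrite lee_fin cost_ge0.
rewrite EFinM -sumEFin; congr (_ * _)%E; apply: eq_bigr => j _.
rewrite ge0_integral_mscale//; last by move=> T _; rewrite lee_fin cost_ge0.
by rewrite integral_dirac// diracT mul1e EFinM.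
Qed.

Lemma max_threshold_mul (R : realType) K M : (0 < M)%N ->
  max_threshold R M (K * M) = K.
Proof.
move=> M0; rewrite /max_threshold natrM mulfK ?pnatr_eq0 -?lt0n//.
by rewrite -[K%:R]/(K%:~R) intrKceil.
Qed.

(** * The optimal ratio when G = K M *)

Section optimum.
Variables (R : realType) (M B K : nat).
Hypotheses (M_gt0 : (0 < M)%N) (K_gt0 : (0 < K)%N) (KB : (K < B)%N).
Let q : R := K%:R.
Let a : R := 1 - q^-1.

Let q_neq0 : q != 0. Proof. by rewrite pnatr_eq0 -lt0n. Qed.

Let qa : q * a = q - 1. Proof. by rewrite /a mulrBr mulr1 mulfV. Qed.

Let a_ge0 : 0 <= a.
Proof. by rewrite subr_ge0 invf_le1 ?ltr0n// ler1n. Qed.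

Let a_lt1 : a < 1.
Proof. by rewrite ltrBlDr ltrDl invr_gt0 ltr0n. Qed.

Let M_neq0 : M%:R != 0 :> R. Proof. by rewrite pnatr_eq0 -lt0n. Qed.

Let aE : 1 - M%:R / (K * M)%:R = a.
Proof. by rewrite /a natrM invfM mulrCA mulfV// mulr1. Qed.

Let expE : (K * M)%:R / M%:R = q. Proof. by rewrite natrM mulfK. Qed.

Let W_gt0 : 0 < 1 - a ^+ K.
Proof. by rewrite subr_gt0 exprn_ilt1// -lt0n. Qed.

(** The exponent K - (j + 1) is a natural number, so the real power is an ordinary one. *)
Let threshold_weightE j : (j < K)%N ->
  threshold_weight R M (K * M) j.+1 = q^-1 * a ^+ (K - j.+1).
Proof.
move=> jK; rewrite /threshold_weight aE expE -natrB// powR_mulrn//.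
by rewrite natrM invfM mulrCA mulfV// mulr1.
Qed.

Let expected_cost_optimal N :
  expected_cost B (K * M) (random_threshold_policy R M (K * M)) N =
  ((1 - a ^+ K)^-1 * (OPT M B (K * M) N)%:R)%:E.
Proof.
have WE : \sum_(j < max_threshold R M (K * M)) threshold_weight R M (K * M) j.+1
    = 1 - a ^+ K.
  rewrite max_threshold_mul//.
  under eq_bigr => j _ do rewrite threshold_weightE//.
  by rewrite -mulr_sumr (geometric_sum _ _ _ qa) mulKf.
rewrite expected_cost_random_threshold WE// max_threshold_mul// OPT_mulE//.
congr (_ * _)%:E.
under eq_bigr => j _.
  rewrite threshold_weightE// cost_threshold//.
  over.
have /subnKC E : (minn K N <= K)%N by exact: geq_minl.
(* The K thresholds split at the effective horizon min(K, N). *)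
have := truncated_geometric_sum _ _ _ qa (minn K N) (K - minn K N).
rewrite E => H.
apply: (mulfI q_neq0); rewrite [in RHS]natrM [RHS]mulrA -H mulr_suml mulr_sumr.
apply: eq_bigr => j _; rewrite mulrA mulVKf// -mulrA; congr (_ * _).
(* As j < K, replacing N by min(K, N) does not change the cost. *)
rewrite leq_min ltn_ord minnA (minn_idPl (ltnW (ltn_ord j))) mulrDl natrM.
by case: ifP; rewrite ?natrM ?mul0r.
Qed.

Lemma competitive_ratio_random_threshold :
  competitive_ratio B (K * M) (random_threshold_policy R M (K * M)) =
  ((1 - a ^+ K)^-1)%:E.
Proof.
rewrite /competitive_ratio.
(* The policy equalizes the ratios over all horizons, so the supremum is over a singleton. *)
rewrite [X in ereal_sup X](_ : _ = [set ((1 - a ^+ K)^-1)%:E]%classic).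
  exact: ereal_sup1.
have E N : (0 < N)%N ->
    (expected_cost B (K * M) (random_threshold_policy R M (K * M)) N
    / ((OPT M B (K * M) N)%:R)%:E = ((1 - a ^+ K)^-1)%:E)%E.
  move=> N0; have O0 : (OPT M B (K * M) N)%:R != 0 :> R.
    by rewrite pnatr_eq0 -lt0n OPT_gt0// ?muln_gt0 ?K_gt0// (leq_trans _ KB).
  by rewrite expected_cost_optimal inver (negbTE O0) -EFinM mulfK.
apply/seteqP; split=> [_ [N N0 <-]|_ ->]; first exact: E.
by exists 1%N => //; exact: E.
Qed.

Lemma competitive_ratio_lower_bound (f : randomized_policy M R) :
  (((1 - a ^+ K)^-1)%:E <= competitive_ratio B (K * M) f)%E.
Proof.
(* The horizon law of [tail_weighted_cost_ge]: index K - 1 carries the remaining mass, at day 2K -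
   1. *)
pose w i := if (i < K.-1)%N then a ^+ i - a ^+ i.+1 else a ^+ K.-1.
pose d i := if (i < K.-1)%N then i.+1 else (K.-1 + K)%N.
have B0 : (0 < B)%N by exact: leq_trans KB.
have sumE (F : nat -> R) : \sum_(i < K.-1.+1) w i * F (d i) =
    \sum_(i < K.-1) (a ^+ i - a ^+ i.+1) * F i.+1 + a ^+ K.-1 * F (K.-1 + K)%N.
  rewrite big_ord_recr /= /w /d ltnn; congr (_ + _).
  by apply: eq_bigr => i _; rewrite ltn_ord.
(* The optimum at day 2K - 1 is K M, as at day K, so this is M times the mean of a horizon truncated
   at K. *)
have sO : \sum_(i < K.-1.+1) w i * (OPT M B (K * M) (d i))%:R =
    (K * M)%:R * (1 - a ^+ K).
  rewrite (sumE (fun N => (OPT M B (K * M) N)%:R)) OPT_mulE//.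
  rewrite (minn_idPl _) ?leq_addl//.
  under eq_bigr => i _.
    rewrite OPT_mulE// (minn_idPr _); last first.
      by rewrite (leq_trans (ltn_ord i))// leq_pred.
    rewrite natrM mulrA; over.
  rewrite -mulr_suml natrM mulrA -mulrDl.
  have := tail_weighted_sum _ _ _ qa K.-1; rewrite prednK// => ->.
  by rewrite mulrAC.
have KM0 : 0 < (K * M)%:R :> R by rewrite ltr0n muln_gt0 K_gt0.
have -> : (1 - a ^+ K)^-1 =
    (K * M)%:R / \sum_(i < K.-1.+1) w i * (OPT M B (K * M) (d i))%:R.
  by rewrite sO invfM mulVKf// gt_eqF.
apply: competitive_ratio_ge => //.
- by rewrite muln_gt0 K_gt0.
- move=> i; rewrite /w; case: ifP => _; last exact: exprn_ge0.
  by rewrite subr_ge0 exprS ler_piMl ?exprn_ge0// ltW.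
- by move=> i; rewrite /d; case: ifP => _//; rewrite addn_gt0 K_gt0 orbT.
- by rewrite sO mulr_gt0.
- move=> pi; rewrite (sumE (fun N => cost B (K * M) pi N)).
  exact: tail_weighted_cost_ge (ltnW KB).
Qed.

End optimum.

Theorem theorem4 (R : realType) (M B G : nat)
    (M_gt0 : (0 < M)%N) (B_gt0 : (0 < B)%N) (G_gt0 : (0 < G)%N)
    (B_lt_G : (B < G)%N) (G_lt_MB : (G < M * B)%N)
    (M_dvd_G : (M %| G)%N) :
  (forall f : randomized_policy M R,
     (competitive_ratio B G (random_threshold_policy R M G)
        <= competitive_ratio B G f)%E) /\
  competitive_ratio B G (random_threshold_policy R M G)
    = (1 / (1 - (1 - M%:R / G%:R) `^ (G%:R / M%:R)))%:E.
Proof.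
have [K GE] := dvdnP M_dvd_G; move: G_gt0 G_lt_MB; rewrite GE mulnC => KM0.
(* Cancelling M in G < M B gives K < B. *)
rewrite ltn_pmul2l// => KB; rewrite mulnC.
have K_gt0 : (0 < K)%N by move: KM0; rewrite muln_gt0 => /andP[].
rewrite competitive_ratio_random_threshold//; split.
  by move=> f; exact: competitive_ratio_lower_bound.
have M_neq0 : M%:R != 0 :> R by rewrite pnatr_eq0 -lt0n.
have -> : M%:R / (K * M)%:R = K%:R^-1 :> R.
  by rewrite natrM invfM mulrCA mulfV// mulr1.
rewrite natrM mulfK// powR_mulrn ?div1r//.
by rewrite subr_ge0 invf_le1 ?ltr0n// ler1n.
Qed.
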